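(* Let $T$ be a nonnegative tensor of order $m$ and dimension $n$. If $T$ is strictly nonnegative, then $\rho(T)>0$.
   Context: Throughout $m,n\ge 2$. A tensor $T$ of order $m$ and dimension $n$ is a real array $(T_{i_1\ldots i_m})$ with $i_1,\dots,i_m\in\{1,\ldots,n\}$; it is nonnegative if all its entries are nonnegative. For $x\in\mathbb{C}^n$, $Tx^{m-1}$ is the vector with $(Tx^{m-1})_i=\sum_{i_2,\ldots,i_m=1}^n T_{ii_2\ldots i_m}x_{i_2}\cdots x_{i_m}$. A number $\lambda\in\mathbb{C}$ is an eigenvalue of $T$ if there is $x\in\mathbb{C}^n\setminus\{0\}$ with $(Tx^{m-1})_i=\lambda x_i^{m-1}$ for all $i$. The spectral radius $\rho(T)$ is the maximum of $|\lambda|$ over all eigenvalues $\lambda\in\mathbb{C}$ of $T$. For nonnegative $T$ define $F_T:\mathbb{R}^n_+\to\mathbb{R}^n_+$ by $(F_T)_i(x)=\left((Tx^{m-1})_i\right)^{1/(m-1)}$. $T$ is strictly nonnegative if $F_T(x)>0$ for every $x>0$ (vector inequalities are componentwise; $x>0$ means all components are positive). *)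

(* Defs.v *)
From HB Require Import structures.
From mathcomp Require Import all_boot all_order all_algebra.
From mathcomp Require Import complex.
From mathcomp Require Import all_classical all_reals all_analysis.

Set Implicit Arguments.
Unset Strict Implicit.
Unset Printing Implicit Defensive.

Import Order.TTheory GRing.Theory Num.Theory.

Local Open Scope classical_set_scope.
Local Open Scope ring_scope.

(** A tensor of order [m] and dimension [n]: the entry T_{i_1 ... i_m} is
    [T [tuple i_1; ...; i_m]]. *)
Definition tensor (K : Type) (m n : nat) := m.-tuple 'I_n -> K.

Definition nonneg_tensor (R : realType) (m n : nat) (T : tensor R m n) : Prop :=
  forall j, 0 <= T j.

(** The vector T x^{m-1}.  For [0 < m], the sum over i_2, ..., i_m is written as
    the sum over all multi-indices (i_1, ..., i_m) with i_1 = i. *)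
Definition tensor_app (K : comNzRingType) (m n : nat) (T : tensor K m n)
    (x : 'rV[K]_n) : 'rV[K]_n :=
  \row_i \sum_(j : m.-tuple 'I_n | ohead j == Some i)
    T j * \prod_(k <- behead j) x 0 k.

Definition complex_tensor (R : realType) (m n : nat) (T : tensor R m n) :
    tensor R[i] m n :=
  fun j => (T j)%:C%C.

Definition tensor_eigenvalue (R : realType) (m n : nat) (T : tensor R m n)
    (lambda : R[i]) : Prop :=
  exists x : 'rV[R[i]]_n, x != 0 /\
    forall i, tensor_app (complex_tensor T) x 0 i = lambda * x 0 i ^+ m.-1.

(** The norm of a complex number is itself an element of [R[i]]; this is the
    set of moduli of eigenvalues as real numbers. *)
Definition eigenvalue_moduli (R : realType) (m n : nat) (T : tensor R m n) :
    set R :=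
  [set r | exists lambda : R[i],
     tensor_eigenvalue T lambda /\ `|lambda| = r%:C%C].

(** The maximum of the moduli of the eigenvalues, with the default value 0 if
    there is no maximum: an inequality [0 < spectral_radius T] thus entails that
    the maximum exists. *)
Definition spectral_radius (R : realType) (m n : nat) (T : tensor R m n) : R :=
  xget 0 (eigenvalue_moduli T `&` ubound (eigenvalue_moduli T)).

Lemma spectral_radius_max (R : realType) (m n : nat) (T : tensor R m n) (r : R) :
  eigenvalue_moduli T r -> ubound (eigenvalue_moduli T) r ->
  spectral_radius T = r.
Proof.
move=> Tr ubr; rewrite /spectral_radius; apply: xget_unique => // s [Ts ubs].
by apply/eqP; rewrite eq_le ubr //= ubs.
Qed.

Definition positive_vector (R : realType) (n : nat) (x : 'rV[R]_n) : Prop :=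
  forall i, 0 < x 0 i.

(** The map F_T; it is only meaningful for nonnegative [T] and [x], where the
    real power [`^] with exponent 1/(m-1) is the usual root (and sends 0 to 0
    as soon as [1 < m]). *)
Definition tensor_map (R : realType) (m n : nat) (T : tensor R m n)
    (x : 'rV[R]_n) : 'rV[R]_n :=
  \row_i (tensor_app T x 0 i `^ (m.-1%:R)^-1).

Definition strictly_nonneg (R : realType) (m n : nat) (T : tensor R m n) : Prop :=
  forall x : 'rV[R]_n, positive_vector x -> positive_vector (tensor_map T x).

(* Main.v *)
Require Import Defs.
From HB Require Import structures.
From mathcomp Require Import all_boot all_order all_algebra.
From mathcomp Require Import complex.
From mathcomp Require Import all_classical all_reals all_analysis.

Set Implicit Arguments.
Unset Strict Implicit.
Unset Printing Implicit Defensive.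

Import Order.TTheory GRing.Theory Num.Theory.
Import numFieldNormedType.Exports.

Local Open Scope ring_scope.

(** Write G x for T x^{m-1} and d for m - 1.  A real r is a subeigenvalue of G
    if r x_i^d <= (G x)_i for all i and some x in the standard simplex.  The
    proof shows that the largest subeigenvalue r exists, is positive, is an
    eigenvalue, and bounds the modulus of every complex eigenvalue; it is then
    the spectral radius.

    Existence of the maximum is compactness of the set of pairs (x, r)
    ([exists_max_subeigen]).  It bounds the moduli because taking moduli in
    T x^{m-1} = lambda x^{[m-1]} gives |lambda| |x_i|^d <= (G |x|)_i by the
    triangle inequality ([eigenvalue_modulus_subeigen]).  It is positive because
    strict nonnegativity makes G u positive for a constant vector u > 0, so
    that a small c > 0 is a subeigenvalue.

    The main point is that the maximum is an eigenvalue ([exists_max_eigen]).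
    Adding e > 0 to all entries of T makes G strictly increasing.  If x attains
    the maximum r for the perturbed map, still written G, but is not an
    eigenvector, let y_i = ((G x)_i)^{1/d}: then y >= r^{1/d} x with y different from r^{1/d} x,
    so G y > r G x = r y^{[d]} in every component, and y improves on r
    ([perturb_max_subeigen]).  This replaces the usual appeal to
    Brouwer's theorem.  The eigenpairs
    of the perturbed maps form with e a compact set, on which e attains a
    minimum; the minimum is 0 and the corresponding pair is an eigenpair of G
    whose eigenvalue is still at least, hence equal to, the maximum for G. *)

(** * Closed sets and continuous functions *)

Lemma closed_le_continuous (R : realType) (U : topologicalType) (f g : U -> R) :
  continuous f -> continuous g -> closed [set x | f x <= g x]%classic.
Proof.
move=> cf cg.
have -> : [set x | f x <= g x]%classic =
          ((fun x => g x - f x) @^-1` [set y | 0 <= y])%classic.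
  by apply/seteqP; split=> x /=; rewrite subr_ge0.
apply: preimage_closed; last exact: closed_ge.
by move=> x _; apply: (@cvgB _ R^o); [exact: cg|exact: cf].
Qed.

Lemma closed_eq_continuous (R : realType) (U : topologicalType) (f g : U -> R) :
  continuous f -> continuous g -> closed [set x | f x = g x]%classic.
Proof.
move=> cf cg.
have -> : [set x | f x = g x]%classic =
          ([set x | f x <= g x] `&` [set x | g x <= f x])%classic.
  apply/seteqP; split=> x /=; first by move=> ->.
  by move=> [fg gf]; apply/eqP; rewrite eq_le fg gf.
by apply: closedI; exact: closed_le_continuous.
Qed.

Lemma continuous_addr (R : realType) (U : topologicalType) (f g : U -> R) :
  continuous f -> continuous g -> continuous (fun x => f x + g x).
Proof. by move=> cf cg x; apply: (@cvgD _ R^o); [exact: cf|exact: cg]. Qed.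

Lemma continuous_mulr (R : realType) (U : topologicalType) (f g : U -> R) :
  continuous f -> continuous g -> continuous (fun x => f x * g x).
Proof. by move=> cf cg x; apply: cvgM; [exact: cf|exact: cg]. Qed.

Lemma continuous_expr (R : realType) (U : topologicalType) (f : U -> R) k :
  continuous f -> continuous (fun x => f x ^+ k).
Proof.
move=> cf x.
apply: (@continuous_comp _ _ _ f (fun z => z ^+ k)); first exact: cf.
exact: exprn_continuous.
Qed.

Lemma continuous_fst_comp (U V W : topologicalType) (f : U -> W) :
  continuous f -> continuous (fun p : U * V => f p.1).
Proof.
move=> cf p; apply: (@continuous_comp _ _ _ fst f); first exact: cvg_fst.
exact: cf.
Qed.

Lemma continuous_snd_comp (U V W : topologicalType) (f : V -> W) :
  continuous f -> continuous (fun p : U * V => f p.2).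
Proof.
move=> cf p; apply: (@continuous_comp _ _ _ snd f); first exact: cvg_snd.
exact: cf.
Qed.

Lemma continuous_sumr (R : realType) (U : topologicalType) (I : Type)
    (r : seq I) (P : pred I) (F : I -> U -> R) :
  (forall i, P i -> continuous (F i)) ->
  continuous (fun x => \sum_(i <- r | P i) F i x).
Proof. by apply: continuous_big; exact: (@add_continuous R^o). Qed.

Lemma continuous_prodr (R : realType) (U : topologicalType) (I : Type)
    (r : seq I) (P : pred I) (F : I -> U -> R) :
  (forall i, P i -> continuous (F i)) ->
  continuous (fun x => \prod_(i <- r | P i) F i x).
Proof. by apply: continuous_big; exact: mul_continuous. Qed.

(** * Auxiliary facts on reals *)

Lemma exists_root (R : realType) (d : nat) (a : R) :
  (0 < d)%N -> 0 <= a -> exists2 y : R, 0 <= y & y ^+ d = a.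
Proof.
move=> d0 a0; exists (a `^ d%:R^-1); first exact: powR_ge0.
by rewrite -powR_mulrn ?powR_ge0// -powRrM mulVf ?powRr1// pnatr_eq0 -lt0n.
Qed.

Lemma exists_gt_lower_bound (R : realType) (I : finType) (q : I -> R) (r : R) :
  (forall i, r < q i) -> exists2 c, r < c & forall i, c <= q i.
Proof.
move=> rq; exists (\big[Order.min/r + 1]_i q i).
  by apply/bigmin_gtP; split => //; rewrite ltrDl.
by move=> i; exact: bigmin_le.
Qed.

(** * The standard simplex *)

Definition simplex (R : realType) (n : nat) : set 'rV[R]_n :=
  [set x | (forall i, 0 <= x 0 i) /\ \sum_i x 0 i = 1]%classic.
Arguments simplex {R n}.

Lemma simplex_le1 (R : realType) (n : nat) (x : 'rV[R]_n) i :
  simplex x -> x 0 i <= 1.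
Proof.
move=> [x0 <-]; rewrite (bigD1 i)//= lerDl.
by apply: sumr_ge0.
Qed.

Lemma simplex_const (R : realType) (n : nat) :
  (0 < n)%N -> simplex (const_mx n%:R^-1 : 'rV[R]_n).
Proof.
move=> n0; split=> [i|]; first by rewrite mxE invr_ge0 ler0n.
under eq_bigr do rewrite mxE.
by rewrite sumr_const card_ord -[LHS]mulr_natr mulVf// pnatr_eq0 -lt0n.
Qed.

Lemma simplex_large_coord (R : realType) (n : nat) (x : 'rV[R]_n) :
  (0 < n)%N -> simplex x -> exists i, n%:R^-1 <= x 0 i.
Proof.
move=> n0 [_ x1]; have [_ n1] := @simplex_const R n n0.
apply: contrapT => /forallNP xn; suff : (1 : R) < 1 by rewrite ltxx.
rewrite -{1}x1 -n1; apply: ltr_sum; first by apply/hasP; exists (Ordinal n0).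
by move=> i _; rewrite mxE ltNge; apply/negP.
Qed.

Lemma compact_simplex (R : realType) (n : nat) : compact (@simplex R n).
Proof.
have cube := @rV_compact R n (fun=> `[0, 1]%classic)
  (fun=> @segment_compact R 0 1).
apply: (subclosed_compact _ cube).
  have -> : @simplex R n =
    (\bigcap_(i : 'I_n) [set x : 'rV[R]_n | 0 <= x 0 i] `&`
     [set x | \sum_i x 0 i = 1])%classic.
    by apply/seteqP; split=> x /= [x0 x1]; split=> // i; [move=> _|];
       apply: x0.
  apply: closedI.
    apply: closed_bigI => i _.
    by apply: closed_le_continuous; [exact: cst_continuous|
      exact: coord_continuous].
  apply: closed_eq_continuous; last exact: cst_continuous.
  by apply: continuous_sumr => i _; exact: coord_continuous.
move=> x xs i /=; rewrite in_itv/= (simplex_le1 _ xs) andbT.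
by case: xs.
Qed.

(** * Largest subeigenvalue of a monotone homogeneous map *)

(** The properties of x |-> T x^{m-1} on which the Perron-Frobenius argument
    rests; they are stable under the perturbation below, so that the argument
    never manipulates tensor entries. *)
Record monotone_homogeneous (R : realType) (n d : nat)
    (G : 'rV[R]_n -> 'rV[R]_n) : Prop := MonotoneHomogeneous {
  mh_continuous : forall i, continuous (fun x => G x 0 i);
  mh_homogeneous : forall c x i, G (c *: x) 0 i = c ^+ d * G x 0 i;
  mh_monotone : forall x y : 'rV[R]_n, (forall i, 0 <= x 0 i) ->
    (forall i, x 0 i <= y 0 i) -> forall i, G x 0 i <= G y 0 i }.

Lemma mh_ge0 (R : realType) (n d : nat) (G : 'rV[R]_n -> 'rV[R]_n)
    (x : 'rV[R]_n) (i : 'I_n) :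
  (0 < d)%N -> monotone_homogeneous d G -> (forall k, 0 <= x 0 k) ->
  0 <= G x 0 i.
Proof.
move=> d0 hG x0; have := mh_homogeneous hG 0 0 i.
rewrite scale0r expr0n eqn0Ngt d0 mul0r => <-.
by apply: (mh_monotone hG) => k; rewrite mxE.
Qed.

(** For d > 0, G nonnegative and x in the simplex, this says that r is at most
    the Collatz-Wielandt quotient of x, the minimum of (G x)_i / x_i ^ d over the
    i with x_i > 0.  That minimum is not continuous at the boundary of the
    simplex, but the inequality without division is closed in (r, x). *)
Definition subeigen (R : realType) (n d : nat) (G : 'rV[R]_n -> 'rV[R]_n)
    (r : R) (x : 'rV[R]_n) : Prop :=
  forall i, r * x 0 i ^+ d <= G x 0 i.

(** Both sides of the subeigenvalue inequality are homogeneous of degree d, so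
    a witness may be searched for outside the simplex. *)
Lemma subeigen_normalize (R : realType) (n d : nat)
    (G : 'rV[R]_n -> 'rV[R]_n) (r : R) (y : 'rV[R]_n) :
  monotone_homogeneous d G -> (forall i, 0 <= y 0 i) -> 0 < \sum_i y 0 i ->
  subeigen d G r y ->
  simplex ((\sum_i y 0 i)^-1 *: y) /\ subeigen d G r ((\sum_i y 0 i)^-1 *: y).
Proof.
move=> hG y0 sy ry; split; first split=> [i|].
- by rewrite mxE mulr_ge0// invr_ge0 ltW.
- under eq_bigr do rewrite mxE.
  by rewrite -mulr_sumr mulVf// gt_eqF.
- move=> i; rewrite (mh_homogeneous hG) mxE exprMn mulrCA ler_pM2l//.
  by rewrite exprn_gt0// invr_gt0.
Qed.

(** Some coordinate of x is at least 1/n, and all are at most 1; evaluate the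
    inequality at the former and use monotonicity for the latter. *)
Lemma subeigen_bound (R : realType) (n d : nat) (G : 'rV[R]_n -> 'rV[R]_n)
    (r : R) (x : 'rV[R]_n) :
  (0 < n)%N -> (0 < d)%N -> monotone_homogeneous d G -> 0 <= r ->
  simplex x -> subeigen d G r x ->
  r <= n%:R ^+ d * \sum_i G (const_mx 1) 0 i.
Proof.
move=> n0 d0 hG r0 xs rx; have [i xi] := simplex_large_coord n0 xs.
have n0R : 0 < n%:R :> R by rewrite ltr0n.
rewrite mulrC -ler_pdivrMr ?exprn_gt0// -exprVn.
apply: (@le_trans _ _ (r * x 0 i ^+ d)).
  by rewrite ler_wpM2l// lerXn2r// nnegrE ?invr_ge0 ?ler0n//; case: xs.
apply: (le_trans (rx i)); apply: (@le_trans _ _ (G (const_mx 1) 0 i)).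
  apply: (mh_monotone hG); first by case: xs.
  by move=> k; rewrite mxE simplex_le1.
rewrite (bigD1 i)//= lerDl; apply: sumr_ge0 => k _.
by apply: (mh_ge0 _ d0 hG) => l; rewrite mxE.
Qed.

Definition max_subeigen (R : realType) (n d : nat) (G : 'rV[R]_n -> 'rV[R]_n)
    (r : R) : Prop :=
  forall s y, simplex y -> subeigen d G s y -> s <= r.

(** The pairs (x, r) with r >= 0 form a compact set thanks to [subeigen_bound],
    and the second projection attains its maximum there; r = 0 always occurs,
    so the maximum over r >= 0 is the maximum over all r. *)
Lemma exists_max_subeigen (R : realType) (n d : nat)
    (G : 'rV[R]_n -> 'rV[R]_n) :
  (0 < n)%N -> (0 < d)%N -> monotone_homogeneous d G ->
  exists r x, [/\ simplex x, subeigen d G r x & max_subeigen d G r].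
Proof.
move=> n0 d0 hG; pose M : R := n%:R ^+ d * \sum_i G (const_mx 1) 0 i.
pose K : set ('rV[R]_n * R) :=
  ((simplex `*` `[0, M]) `&` \bigcap_(i : 'I_n)
     [set p : 'rV[R]_n * R | p.2 * p.1 0 i ^+ d <= G p.1 0 i])%classic.
have Kc : compact K.
  apply: compact_closedI.
    by apply: compact_setX; [exact: compact_simplex|exact: segment_compact].
  apply: closed_bigI => i _; apply: closed_le_continuous.
    apply: continuous_mulr; first by move=> p; exact: cvg_snd.
    apply/continuous_expr.
    apply: (@continuous_fst_comp _ _ _ (fun x : 'rV[R]_n => x 0 i)).
    exact: coord_continuous.
  apply: (@continuous_fst_comp _ _ _ (fun x : 'rV[R]_n => G x 0 i)).
  exact: (mh_continuous hG).
have inK s y : simplex y -> subeigen d G s y -> 0 <= s -> K (y, s).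
  move=> ys sy s0; split; last by move=> i _; exact: sy.
  split=> //=; rewrite in_itv/= s0/=; exact: (subeigen_bound n0 d0 hG s0 ys).
have K0 : K (const_mx n%:R^-1, 0).
  apply: inK => // [|i]; first exact: simplex_const.
  rewrite mul0r; apply: (mh_ge0 _ d0 hG) => k.
  by rewrite mxE invr_ge0 ler0n.
have [||[x r]] := @compact_EVT_max _ R snd K _ Kc.
- by exists (const_mx n%:R^-1, 0).
- by apply: continuous_subspaceT => p; exact: cvg_snd.
rewrite inE => -[[/= xs]]; rewrite in_itv/= => /andP[r0 _] rx rmax.
exists r, x; split=> // [i|s y ys sy]; first exact: rx.
have [s0|s0] := leP 0 s; last exact: le_trans (ltW s0) r0.
by apply: (rmax (y, s)); rewrite inE; exact: inK.
Qed.

(** * Perturbation by the all-ones tensor *)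

(** When G is the map of a tensor of order d + 1, this is the map of the tensor
    with e added to all the entries: the all-ones tensor maps x to the constant
    vector (x_1 + ... + x_n)^d.  On the simplex the added term is just e. *)
Definition perturb (R : realType) (n d : nat) (G : 'rV[R]_n -> 'rV[R]_n)
    (e : R) (x : 'rV[R]_n) : 'rV[R]_n :=
  \row_i (G x 0 i + e * (\sum_k x 0 k) ^+ d).

Lemma perturb_monotone_homogeneous (R : realType) (n d : nat)
    (G : 'rV[R]_n -> 'rV[R]_n) (e : R) :
  0 <= e -> monotone_homogeneous d G -> monotone_homogeneous d (perturb d G e).
Proof.
move=> e0 hG; split.
- move=> i.
  have -> : (fun x => perturb d G e x 0 i) =
      (fun x => G x 0 i + e * (\sum_k x 0 k) ^+ d).
    by apply/funext => x; rewrite mxE.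
  apply: continuous_addr; first exact: (mh_continuous hG).
  apply: continuous_mulr; first exact: cst_continuous.
  by apply/continuous_expr/continuous_sumr => k _; exact: coord_continuous.
- move=> c x i; rewrite !mxE (mh_homogeneous hG) mulrDr.
  under eq_bigr do rewrite mxE.
  by rewrite -mulr_sumr exprMn [e * _]mulrCA.
- move=> x y x0 xy i; rewrite !mxE lerD ?(mh_monotone hG)//.
  have sx : 0 <= \sum_k x 0 k by exact: sumr_ge0.
  have sxy : \sum_k x 0 k <= \sum_k y 0 k by exact: ler_sum.
  by rewrite ler_wpM2l// lerXn2r// nnegrE (le_trans sx).
Qed.

Lemma perturb_lt (R : realType) (n d : nat) (G : 'rV[R]_n -> 'rV[R]_n) (e : R)
    (x y : 'rV[R]_n) i0 :
  (0 < d)%N -> 0 < e -> monotone_homogeneous d G ->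
  (forall i, 0 <= x 0 i) -> (forall i, x 0 i <= y 0 i) -> x 0 i0 < y 0 i0 ->
  forall i, perturb d G e x 0 i < perturb d G e y 0 i.
Proof.
move=> d0 e0 hG x0 xy xyi i; rewrite !mxE ler_ltD ?(mh_monotone hG)//.
have sx : 0 <= \sum_k x 0 k by exact: sumr_ge0.
have sxy : \sum_k x 0 k < \sum_k y 0 k.
  rewrite (bigD1 i0)//= [ltRHS](bigD1 i0)//= ltr_leD//.
  exact: ler_sum.
by rewrite ltr_pM2l// ltrXn2r// -?lt0n.
Qed.

(** At a maximiser that is not an eigenvector, one step of the normalised power
    iteration x |-> (G x)^{1/d} would produce a strictly larger subeigenvalue,
    by [perturb_lt]. *)
Lemma perturb_max_subeigen (R : realType) (n d : nat)
    (G : 'rV[R]_n -> 'rV[R]_n) (e r : R) (x : 'rV[R]_n) :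
  (0 < d)%N -> 0 < e -> monotone_homogeneous d G -> simplex x ->
  subeigen d (perturb d G e) r x -> max_subeigen d (perturb d G e) r ->
  forall i, perturb d G e x 0 i = r * x 0 i ^+ d.
Proof.
move=> d0 e0 hG xs rx rmax.
set H := perturb d G e in rx rmax *.
have hH : monotone_homogeneous d H.
  by apply: perturb_monotone_homogeneous => //; exact: ltW.
have [x0 x1] := xs.
have r0 : 0 <= r.
  by apply: (rmax 0 x) => // i; rewrite mul0r; exact: (mh_ge0 _ d0 hH).
have Hx_gt0 i : 0 < H x 0 i.
  by rewrite mxE x1 expr1n mulr1 ltr_wpDl// (mh_ge0 _ d0 hG).
have [s s0 sr] := exists_root d0 r0.
pose y : 'rV[R]_n := \row_i sval (cid2 (exists_root d0 (ltW (Hx_gt0 i)))).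
have y_ge0 i : 0 <= y 0 i by rewrite mxE; case: cid2.
have yE i : y 0 i ^+ d = H x 0 i by rewrite mxE; case: cid2.
have y_gt0 i : 0 < y 0 i.
  rewrite lt_neqAle y_ge0 andbT; apply/eqP => yi.
  by have := Hx_gt0 i; rewrite -yE -yi expr0n eqn0Ngt d0 ltxx.
have sx0 i : 0 <= (s *: x) 0 i by rewrite mxE mulr_ge0.
have sxE i : (s *: x) 0 i ^+ d = r * x 0 i ^+ d by rewrite mxE exprMn sr.
have sxy i : (s *: x) 0 i <= y 0 i.
  by rewrite -(ler_pXn2r d0) ?nnegrE// sxE yE.
apply: contrapT => /existsNP[i0 /eqP Hi0].
have sxy0 : (s *: x) 0 i0 < y 0 i0.
  by rewrite -(ltr_pXn2r d0) ?nnegrE// sxE yE lt_neqAle rx eq_sym Hi0.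
have Hy i : r < H y 0 i / y 0 i ^+ d.
  rewrite ltr_pdivlMr ?exprn_gt0// yE -sr -(mh_homogeneous hH).
  exact: perturb_lt sxy0 i.
(* All the quotients exceed r, and there are finitely many of them. *)
have [c rc cH] := exists_gt_lower_bound Hy.
have sy : 0 < \sum_i y 0 i.
  rewrite (bigD1 i0)//= ltr_wpDr//; exact: sumr_ge0.
have cy : subeigen d H c y by move=> i; rewrite -ler_pdivlMr ?exprn_gt0.
have [ys' cy'] := subeigen_normalize hH y_ge0 sy cy.
by have := rmax _ _ ys' cy'; rewrite leNgt rc.
Qed.

(** * The largest subeigenvalue is an eigenvalue *)

(** Passage to the limit e -> 0 without sequences: the eigenpairs (x, r) of the
    perturbed maps, for e in [0, 1], form with e a compact set, and the minimum
    of e on it must be 0 because each e in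
    (0, 1] occurs.  The bounds on r come from
    comparing the perturbed map with G from below and with its perturbation by
    1 from above. *)
Lemma exists_max_eigen (R : realType) (n d : nat) (G : 'rV[R]_n -> 'rV[R]_n) :
  (0 < n)%N -> (0 < d)%N -> monotone_homogeneous d G ->
  exists r x, [/\ simplex x, (forall i, G x 0 i = r * x 0 i ^+ d) &
    max_subeigen d G r].
Proof.
move=> n0 d0 hG; have [r0 [x0 [xs0 rx0 rmax0]]] := exists_max_subeigen n0 d0 hG.
have hP e : 0 <= e -> monotone_homogeneous d (perturb d G e).
  by move=> ?; exact: perturb_monotone_homogeneous.
have [r1 [_ [_ _ rmax1]]] := exists_max_subeigen n0 d0 (hP 1 ler01).
have perturbE e x i : simplex x -> perturb d G e x 0 i = G x 0 i + e.
  by move=> [_ x1]; rewrite mxE x1 expr1n mulr1.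
pose K : set ('rV[R]_n * (R * R)) :=
  ((simplex `*` (`[r0, r1] `*` `[0, 1])) `&` \bigcap_(i : 'I_n)
     [set p : 'rV[R]_n * (R * R) |
       G p.1 0 i + p.2.2 = p.2.1 * p.1 0 i ^+ d])%classic.
have c22 : continuous (fun p : 'rV[R]_n * (R * R) => p.2.2).
  by apply: (@continuous_snd_comp _ _ _ snd) => p; exact: cvg_snd.
have Kc : compact K.
  apply: compact_closedI.
    apply: compact_setX; first exact: compact_simplex.
    by apply: compact_setX; exact: segment_compact.
  apply: closed_bigI => i _; apply: closed_eq_continuous.
    apply: continuous_addr c22.
    apply: (@continuous_fst_comp _ _ _ (fun x : 'rV[R]_n => G x 0 i)).
    exact: (mh_continuous hG).
  apply: continuous_mulr.
    by apply: (@continuous_snd_comp _ _ _ fst) => p; exact: cvg_fst.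
  apply/continuous_expr.
  apply: (@continuous_fst_comp _ _ _ (fun x : 'rV[R]_n => x 0 i)).
  exact: coord_continuous.
have inK e : 0 < e -> e <= 1 -> exists p, K p /\ p.2.2 = e.
  move=> e0 e1.
  have [r [x [xs rx rmax]]] := exists_max_subeigen n0 d0 (hP e (ltW e0)).
  have xr := perturb_max_subeigen d0 e0 hG xs rx rmax.
  exists (x, (r, e)); split=> //; split; last first.
    by move=> i _ /=; rewrite -(perturbE _ _ _ xs).
  split=> //=; rewrite !in_itv/= (ltW e0) e1; split=> //.
  apply/andP; split.
    apply: (rmax _ x0) => // i.
    by rewrite perturbE//; apply: le_trans (rx0 i) _; rewrite lerDl ltW.
  apply: (rmax1 _ x) => // i; apply: le_trans (rx i) _.
  by rewrite !perturbE// lerD2l.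
have [||[x [r e]]] := @compact_EVT_min _ R
  (fun p : 'rV[R]_n * (R * R) => p.2.2) K _ Kc.
- by have [p [Kp _]] := inK 1 ltr01 (lexx _); exists p.
- exact: continuous_subspaceT.
rewrite inE => -[[/= xs]]; rewrite !in_itv/= => -[/andP[r0r _] /andP[e0 e1]] xr.
move=> emin.
have {e1} e00 : e = 0.
  apply/eqP; rewrite eq_le e0 andbT leNgt; apply/negP => egt0.
  have [||p [Kp pe]] := inK (e / 2); first by rewrite divr_gt0.
    by rewrite ler_pdivrMr// mul1r (le_trans e1)// ler1n.
  have /emin : p \in K by rewrite inE.
  by rewrite pe leNgt ltr_pdivrMr// ltr_pMr// ltr1n.
have {}xr i : G x 0 i = r * x 0 i ^+ d by rewrite -(xr i)//= e00 addr0.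
(* An eigenvalue is a subeigenvalue, so r cannot exceed the maximum r0. *)
have rr0 : r = r0.
  apply/eqP; rewrite eq_le r0r andbT.
  by apply: (rmax0 _ x) => // i; rewrite xr.
by exists r, x; split=> //; rewrite rr0.
Qed.

(** * Tensors *)

Lemma tensor_app_monotone_homogeneous (R : realType) (m n : nat)
    (T : tensor R m n) :
  nonneg_tensor T -> monotone_homogeneous m.-1 (tensor_app T).
Proof.
move=> hT; split.
- move=> i.
  have -> : (fun x => tensor_app T x 0 i) = (fun x : 'rV[R]_n =>
      \sum_(j : m.-tuple 'I_n | ohead j == Some i)
        T j * \prod_(k <- behead j) x 0 k).
    by apply/funext => x; rewrite mxE.
  apply: continuous_sumr => j _; apply: continuous_mulr.
    exact: cst_continuous.
  by apply: continuous_prodr => k _; exact: coord_continuous.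
- move=> c x i; rewrite !mxE mulr_sumr; apply: eq_bigr => j _.
  rewrite [RHS]mulrCA; congr (_ * _).
  under eq_bigr do rewrite mxE.
  rewrite big_split/= big_const_seq count_predT iter_mulr_1.
  by rewrite size_behead size_tuple.
- move=> x y x0 xy i; rewrite !mxE; apply: ler_sum => j _.
  by apply: ler_wpM2l => //; apply: ler_prod => k _; rewrite x0 xy.
Qed.

Lemma complex_tensor_app (R : realType) (m n : nat) (T : tensor R m n)
    (x : 'rV[R]_n) i :
  tensor_app (complex_tensor T) (map_mx (real_complex R) x) 0 i =
  (tensor_app T x 0 i)%:C%C.
Proof.
rewrite !mxE raddf_sum; apply: eq_bigr => j _.
rewrite /complex_tensor -[RHS]/(real_complex R _) rmorphM rmorph_prod.
by congr (_ * _); apply: eq_bigr => k _; rewrite mxE.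
Qed.

(** The vector of moduli of an eigenvector is a witness, by the triangle
    inequality and the nonnegativity of T. *)
Lemma eigenvalue_modulus_subeigen (R : realType) (m n : nat) (T : tensor R m n)
    (r : R) :
  nonneg_tensor T -> eigenvalue_moduli T r ->
  exists2 y, simplex y & subeigen m.-1 (tensor_app T) r y.
Proof.
move=> hT [lambda [[x [xneq0 xl]] lr]].
pose y : 'rV[R]_n := \row_i complex.Re `|x 0 i|.
have yE i : (y 0 i)%:C%C = `|x 0 i| by rewrite mxE normc_def.
have y0 i : 0 <= y 0 i by rewrite -lecR yE normr_ge0.
have sy : 0 < \sum_i y 0 i.
  rewrite lt_neqAle sumr_ge0// andbT eq_sym.
  apply: contra xneq0; rewrite psumr_eq0// => /allP ya.
  apply/eqP/rowP => i; rewrite mxE; apply/normr0_eq0.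
  by rewrite -yE; have /eqP -> := ya i (mem_index_enum _).
have ry : subeigen m.-1 (tensor_app T) r y.
  move=> i; rewrite -lecR -[leLHS]/(real_complex R _) rmorphM rmorphXn /=.
  rewrite yE -lr -normrX -normrM -xl -complex_tensor_app !mxE.
  apply: (le_trans (ler_norm_sum _ _ _)); apply: ler_sum => j _.
  rewrite normrM normr_prod /complex_tensor ger0_norm ?lecR//.
  rewrite ler_wpM2l ?lecR//.
  by apply: ler_prod => k _; rewrite normr_ge0 mxE yE lexx.
have hG := tensor_app_monotone_homogeneous hT.
by have [] := subeigen_normalize hG y0 sy ry; exists ((\sum_i y 0 i)^-1 *: y).
Qed.

(** Strict nonnegativity is a condition on (m-1)-th roots; it passes to
    T x^{m-1} because the root of 0 is 0. *)
Lemma strictly_nonneg_app_gt0 (R : realType) (m n : nat) (T : tensor R m n)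
    (x : 'rV[R]_n) i :
  (2 <= m)%N -> nonneg_tensor T -> strictly_nonneg T -> positive_vector x ->
  0 < tensor_app T x 0 i.
Proof.
move=> hm hT hsT x0; have := hsT x x0 i; rewrite mxE.
have hG := tensor_app_monotone_homogeneous hT.
have d0 : (0 < m.-1)%N by rewrite -subn1 subn_gt0.
have := mh_ge0 i d0 hG (fun k => ltW (x0 k)).
rewrite le_eqVlt => /orP[/eqP <-|//].
by rewrite powR0 ?ltxx// invr_neq0// pnatr_eq0 -lt0n.
Qed.

Theorem theorem2p1 (R : realType) (m n : nat) (hm : (2 <= m)%N) (hn : (2 <= n)%N)
    (T : tensor R m n) (hT : nonneg_tensor T) (hsT : strictly_nonneg T) :
  0 < spectral_radius T.
Proof.
have d0 : (0 < m.-1)%N by rewrite -subn1 subn_gt0.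
have n0 : (0 < n)%N by exact: ltnW.
have hG := tensor_app_monotone_homogeneous hT.
have [r [x [xs xr rmax]]] := exists_max_eigen n0 d0 hG.
have r0 : 0 < r.
  pose u : 'rV[R]_n := const_mx n%:R^-1.
  have u0 : positive_vector u by move=> i; rewrite mxE invr_gt0 ltr0n.
  have Tu i : 0 < tensor_app T u 0 i / u 0 i ^+ m.-1.
    by rewrite divr_gt0 ?exprn_gt0//; exact: strictly_nonneg_app_gt0.
  have [c c0 cT] := exists_gt_lower_bound Tu.
  apply: (lt_le_trans c0); apply: (rmax _ u); first exact: simplex_const.
  by move=> i; rewrite -ler_pdivlMr ?exprn_gt0.
rewrite (@spectral_radius_max R m n T r)//.
- exists r%:C%C; split; last by rewrite ger0_norm// lecR ltW.
  exists (map_mx (real_complex R) x); split.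
    apply/eqP => /rowP x00; have [_] := xs.
    rewrite big1 => [/eqP|i _]; first by rewrite eq_sym oner_eq0.
    by have := x00 i; rewrite !mxE => -[].
  move=> i; rewrite complex_tensor_app xr -[LHS]/(real_complex R _).
  by rewrite rmorphM rmorphXn mxE.
- move=> s /(eigenvalue_modulus_subeigen hT)[y ys sy].
  exact: rmax ys sy.
Qed.
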